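(* Let $(X,d)$ be a locally compact metric Baire space. If a homeomorphism group $G$ acts chaotically on $X$, then $G$ is sensitive to initial conditions.
   Context: A homeomorphism group of $X$ is a group of homeomorphisms of $X$ onto itself (no topology on the group is assumed). The orbit of $x$ is $G.x=\{g.x : g\in G\}$; a closed (non-closed) orbit is an orbit that is (is not) a closed subset of $X$. A group of homeomorphisms $G$ of a topological space $X$ is chaotic (acts chaotically) on $X$ if (1) there exists a dense non-closed orbit of $G$ in $X$, and (2) the union of the closed orbits of $G$ is dense in $X$. A Baire space is a topological space in which every countable intersection of open dense subsets is dense. A Hausdorff space is locally compact if each of its points has an open neighborhood with compact closure. A homeomorphism group $G$ of a metric space $(X,d)$ is sensitive to initial conditions if there exists $\delta>0$ such that for every nonempty open subset $U\subset X$ there exists $g\in G$ with $\operatorname{diam}(g.U)\ge\delta$ (the diameter is taken in $[0,\infty]$). *)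

(* Defs.v *)
From HB Require Import structures.
From mathcomp Require Import all_boot all_order all_algebra.
From mathcomp Require Import all_classical all_reals all_analysis.

Set Implicit Arguments.
Unset Strict Implicit.
Unset Printing Implicit Defensive.

Local Open Scope classical_set_scope.
Local Open Scope ring_scope.

Definition homeomorphism (T U : topologicalType) (f : T -> U) : Prop :=
  continuous f /\ exists g : U -> T, [/\ cancel f g, cancel g f & continuous g].

(* A group of self-homeomorphisms is the set of its elements, seen as plain
   functions; no topology is put on it. *)
Definition homeomorphism_group (T : topologicalType) (G : set (T -> T)) : Prop :=
  [/\ (forall f, G f -> homeomorphism f),
      G idfun,
      (forall f g, G f -> G g -> G (f \o g)) &
      (forall f g, G f -> cancel f g -> cancel g f -> G g)].

Definition group_orbit (T : Type) (G : set (T -> T)) (x : T) : set T :=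
  [set g x | g in G].

Definition chaotic (T : topologicalType) (G : set (T -> T)) : Prop :=
  (exists x, dense (group_orbit G x) /\ ~ closed (group_orbit G x)) /\
  dense (\bigcup_(x in [set x | closed (group_orbit G x)]) group_orbit G x).

Definition baire_space (T : topologicalType) : Prop :=
  forall F : (set T)^nat,
    (forall n, open (F n) /\ dense (F n)) -> dense (\bigcap_n F n).

(* The element 0 is added so that the empty set has diameter 0, not -oo. *)
Definition diam (R : realType) (X : metricType R) (A : set X) : \bar R :=
  ereal_sup (0%E |` [set (mdist p.1 p.2)%:E | p in A `*` A]).

Definition sensitive (R : realType) (X : metricType R) (G : set (X -> X)) : Prop :=
  exists2 delta : R, 0 < delta &
    forall U : set X, open U -> U !=set0 ->
      exists2 g, G g & (delta%:E <= diam (g @` U))%E.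

(* Main.v *)
Require Import Defs.
From mathcomp Require Import all_boot all_order all_algebra.
From mathcomp Require Import all_classical all_reals all_analysis.
From mathcomp Require Import lra.

(** Suppose [G] is not sensitive.  Its families of uniformly small open sets are
    [G]-invariant, so the point [x] with dense orbit is a point of equicontinuity.
    Let [z] be arbitrary and let [y] be a point near [x] with closed orbit.  When
    [g x] is close to [z], [g y] lies in a compact neighbourhood of [z], so these
    [g y] accumulate at some [w], and [w = h y] because the orbit of [y] is
    closed.  Then [h^-1 g y] returns near [y], hence [h^-1 g x] is near [x], and
    so is [h^-1 z].  Thus [x] lies in the closure of the orbit of every [z];
    taking [z] with closed orbit makes the orbit of [x] closed. *)

Import Order.TTheory GRing.Theory Num.Theory.
Local Open Scope classical_set_scope.

Lemma group_orbit_act (T : topologicalType) (G : set (T -> T)) (g : T -> T)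
    (x : T) : homeomorphism_group G -> G g ->
  group_orbit G (g x) = group_orbit G x.
Proof.
move=> [Ghom _ Gcomp Ginv] Gg; apply/seteqP; split=> _ [h Gh <-].
  by exists (h \o g) => //; exact: Gcomp.
have [_ [g' [gK g'K _]]] := Ghom _ Gg.
exists (h \o g'); last by rewrite /= gK.
by apply: Gcomp => //; exact: Ginv gK g'K.
Qed.

Lemma dense_open_orbit (T : topologicalType) (G : set (T -> T)) (x : T)
    (U : set T) : dense (group_orbit G x) -> open U -> U !=set0 ->
  exists2 g, G g & U (g x).
Proof.
by move=> xD Uo U0; have [u [Uu [g Gg gxu]]] := xD _ U0 Uo; exists g; rewrite ?gxu.
Qed.

Lemma mdist_le_diam (R : realType) (X : metricType R) (A : set X) (p q : X) :
  A p -> A q -> ((mdist p q)%:E <= diam A)%E.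
Proof. by move=> Ap Aq; apply: ereal_sup_ubound; right; exists (p, q). Qed.

Lemma not_sensitive_equicontinuous (R : realType) (X : metricType R)
    (G : set (X -> X)) (x : X) (e : R) : homeomorphism_group G ->
  dense (group_orbit G x) -> ~ sensitive G -> (0 < e)%R ->
  \forall y \near x, forall g, G g -> ball (g x) e (g y).
Proof.
move=> [Ghom _ Gcomp Ginv] xD nsens e0.
have [U [Uo U0 UG]] : exists U : set X, [/\ open U, U !=set0 &
    forall g, G g -> (diam (g @` U) < e%:E)%E].
  apply: contrapT => nU; apply: nsens; exists e => // U Uo U0.
  apply: contrapT => nG; apply: nU; exists U; split=> // g Gg.
  by rewrite ltNge; apply/negP => eU; apply: nG; exists g.
have [a Ga Uax] := dense_open_orbit _ _ _ _ xD Uo U0.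
have [acont [b [aK bK _]]] := Ghom _ Ga.
have Gb : G b by exact: Ginv aK bK.
have : nbhs x (a @^-1` U) by apply: acont; exact: open_nbhs_nbhs.
apply: filterS => y Uay g Gg.
have {UG} := UG _ (Gcomp _ _ Gg Gb); apply: contraPP.
rewrite ballEmdist /= => /negP; rewrite -leNgt => egxy.
apply/negP; rewrite -leNgt.
apply: (@le_trans _ _ (mdist (g x) (g y))%:E); first by rewrite lee_fin.
by apply: mdist_le_diam; [exists (a x)|exists (a y)]; rewrite //= aK.
Qed.

Lemma equicontinuous_orbit_closure (R : realType) (X : metricType R)
    (G : set (X -> X)) (x z : X) : homeomorphism_group G ->
  locally_compact [set: X] ->
  dense (group_orbit G x) ->
  dense (\bigcup_(y in [set y | closed (group_orbit G y)]) group_orbit G y) ->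
  (forall e : R, (0 < e)%R ->
    \forall y \near x, forall g, G g -> ball (g x) e (g y)) ->
  closure (group_orbit G z) x.
Proof.
move=> Ggrp lc xD closedD eqc.
have [Ghom Gid Gcomp Ginv] := Ggrp.
have [K zK [Kcpt _]] := lc z I; rewrite withinET in zK.
have [r /= r0 rK] := (nbhs_ballP _ _).1 zK.
move=> B /nbhs_ballP[d /= d0 dB].
(* The bound [d / 3] pays for the three links from [x] to [k z] at the end; [r / 2] keeps [g y] in
   [K] once [g x] is within [r / 2] of [z]. *)
pose e : R := (Num.min (d / 3) (r / 2))%R.
have e0 : (0 < e)%R by rewrite lt_min !divr_gt0.
have [V [Vo Vx] Veqc] : exists2 V, open_nbhs x V &
    forall y, V y -> forall g, G g -> ball (g x) e (g y).
  have : nbhs x [set y | forall g, G g -> ball (g x) e (g y)] by exact: eqc.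
  by rewrite nbhsE => -[V Vx VE]; exists V.
have [y [Vy [y' y'cl yy']]] := closedD _ (ex_intro _ x Vx) Vo.
have ycl : closed (group_orbit G y).
  by case: yy' => h Gh <-; rewrite group_orbit_act.
pose near_z s := [set g | G g /\ ball z s (g x)].
(* [F] follows [g y] as [g x] tends to [z]; density of the orbit of [x] makes it proper. *)
pose F := filter_from [set s : R | (0 < s)%R]
  (fun s => [set g y | g in near_z s]).
have FF : ProperFilter F.
  apply: filter_from_proper => [|s s0].
    apply: filter_from_filter; first by exists 1%R => /=; exact: ltr01.
    move=> s t s0 t0; exists (Num.min s t); first by rewrite /= lt_min s0.
    move=> _ [g [Gg gz] <-]; split; exists g => //; split=> //;
      by apply: le_ball gz; rewrite ge_min lexx ?orbT.
  have [g Gg gz] : exists2 g, G g & (ball z s)^° (g x).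
    apply: dense_open_orbit => //; first exact: open_interior.
    by exists z; exact: nbhsx_ballx.
  by exists (g y), g => //; split=> //; exact: interior_subset.
have FK : F K.
  exists (r / 2)%R; first by rewrite /= divr_gt0.
  move=> _ [g [Gg gz] <-]; apply: rK; rewrite [r]splitr.
  apply: ball_triangle gz _; apply: le_ball (Veqc _ Vy _ Gg).
  by rewrite ge_min lexx orbT.
have FG : F (group_orbit G y).
  by exists 1%R; [exact: ltr01 | move=> _ [g [Gg _] <-]; exists g].
have [w [_ Fw]] := Kcpt _ FF FK.
have [h Gh hyw] : group_orbit G y w.
  by apply: ycl; move: Fw; rewrite clusterE; exact.
have [_ [k [hK kK kcont]]] := Ghom _ Gh.
have Gk : G k by exact: Ginv hK kK.
have [s /= s0 sz] : nbhs_ball z (k @^-1` ball (k z) e).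
  by apply/nbhs_ballP; apply: kcont; exact: nbhsx_ballx.
(* Since [w = h y] and [k] inverts [h], [k] brings [w] back to [y] in [V]. *)
have wV : nbhs w (k @^-1` V).
  by apply: kcont; rewrite -hyw hK; exact: open_nbhs_nbhs.
have Fs : F [set g y | g in near_z s] by exists s.
have [_ [[g [Gg gz] <-] Vkgy]] := Fw _ _ Fs wV.
exists (k z); split; first by exists k.
(* The links are [x], [k (g y)], [k (g x)], [k z]: equicontinuity for the identity at [k (g y)],
   then for [k \o g] at [y], then continuity of [k] at [z]. *)
apply: dB; apply: (@le_ball _ _ _ (e + e + e)%R).
  have : (e <= d / 3)%R by rewrite ge_min lexx.
  by move: (e) => u; lra.
apply: ball_triangle (ball_sym (sz _ gz)).
apply: (ball_triangle (y := k (g y))).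
  by have := Veqc _ Vkgy _ Gid.
exact/ball_sym/(Veqc _ Vy _ (Gcomp _ _ Gk Gg)).
Qed.

Theorem theorem1p5 (R : realType) (X : metricType R)
    (hlc : locally_compact [set: X]) (hbaire : baire_space X)
    (G : set (X -> X)) (hG : homeomorphism_group G) (hchaos : chaotic G) :
  sensitive G.
Proof.
have [[x [xD xncl]] closedD] := hchaos.
apply: contrapT => nsens.
have [_ [_ [z zcl _]]] := closedD setT (ex_intro _ x I) openT.
have : closure (group_orbit G z) x.
  apply: equicontinuous_orbit_closure => // e e0.
  exact: not_sensitive_equicontinuous.
(* Closedness puts [x] itself in the orbit of [z], so the two orbits coincide. *)
move=> /zcl[f Gf fzx].
by apply: xncl; rewrite -fzx group_orbit_act.
Qed.
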